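(* Let $\varepsilon \in (0,1)$ and let $X \subset \mathbb{R}^d$ be a dataset of $n$ non-negative $s$-sparse vectors. There is an absolute constant $c>0$ such that the following holds: let $f: \mathbb{R}^d \rightarrow \mathbb{R}^{m}$ be the random base mapping with $m = c s/\varepsilon^2$ (chosen independently of $X$), and let $\tilde{X} = \{f(x) \mid x \in X\}$ (as a multiset indexed by $X$). Then for every $p \ge 1$, \[ \mathbb{E}\left[\left | \mathrm{MaxCut}_p(\tilde{X}) - \mathrm{MaxCut}_p(X) \right|\right] \le O(\varepsilon) \cdot \mathrm{MaxCut}_p(X) . \]
   Context: The base mapping $f: \mathbb{R}^d \rightarrow \mathbb{R}^m$ is random and defined as follows. Pick a uniformly random function $h: [d] \rightarrow [m]$; for $i \in [m]$ let $S_i = \{ j \in [d] \mid h(j) = i\}$; for $x \in \mathbb{R}^d$ set $f(x)_i = \max\{ x_j \mid j \in S_i\}$ if $S_i \neq \emptyset$ and $f(x)_i = 0$ otherwise. For a finite (multi)set $Y$ of points, $\mathrm{MaxCut}_p(Y) = \max_{S \subseteq Y} \sum_{x \in S,\, y \in Y \setminus S} \|x-y\|_p^p$. A vector is $s$-sparse if it has at most $s$ non-zero coordinates. *)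

(* Defs.v *)
From HB Require Import structures.
From mathcomp Require Import all_boot all_order all_algebra.
From mathcomp Require Import all_classical all_reals all_analysis.

Set Implicit Arguments.
Unset Strict Implicit.
Unset Printing Implicit Defensive.

Import Order.TTheory GRing.Theory Num.Theory.

Local Open Scope classical_set_scope.
Local Open Scope ring_scope.

Definition nonneg_vec (R : realType) (d : nat) (x : 'rV[R]_d) : Prop :=
  forall j, 0 <= x 0 j.

Definition sparse (R : realType) (d s : nat) (x : 'rV[R]_d) : Prop :=
  (#|[pred j : 'I_d | x 0%R j != 0%R]| <= s)%N.

(* If the bucket is non-empty, the bigop starts from one of its own
   coordinates, so it is the maximum even when all of them are negative. *)
Definition basemap (R : realType) (d m : nat) (h : {ffun 'I_d -> 'I_m})
    (x : 'rV[R]_d) : 'rV[R]_m :=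
  \row_(i < m)
    if [pick j : 'I_d | h j == i] is Some j0
    then \big[Num.max/x 0 j0]_(j | h j == i) x 0 j
    else 0.

Definition uniform_random_function (R : realType) (disp : measure_display)
    (Omega : measurableType disp) (P : probability Omega R) (d m : nat)
    (h : Omega -> {ffun 'I_d -> 'I_m}) : Prop :=
  forall g : {ffun 'I_d -> 'I_m},
    measurable (h @^-1` [set g]) /\
    P (h @^-1` [set g]) = ((#|{ffun 'I_d -> 'I_m}|)%:R^-1)%:E.

Definition lpnorm (R : realType) (d : nat) (p : R) (x : 'rV[R]_d) : R :=
  (\sum_(k < d) `|x 0 k| `^ p) `^ p^-1.

(* A finite multiset of points is a family Y indexed by a finite type.
   The default value 0 of the maximum is harmless: all cuts are nonnegative
   and the cut of the empty set is 0. *)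
Definition maxcut (R : realType) (I : finType) (d : nat) (p : R)
    (Y : I -> 'rV[R]_d) : R :=
  \big[Num.max/0]_(S : {set I})
    \sum_(i in S) \sum_(j in ~: S) lpnorm p (Y i - Y j) `^ p.

(* Main.v *)
Require Import Defs.
From HB Require Import structures.
From mathcomp Require Import all_boot all_order all_algebra.
From mathcomp Require Import all_classical all_reals all_analysis.
From mathcomp Require Import measurable_realfun.

Import Order.TTheory GRing.Theory Num.Theory.

Local Open Scope classical_set_scope.
Local Open Scope ring_scope.

(** Since the maximum is 1-Lipschitz for the sup norm, the base mapping never
    increases an l_p^p distance, so MaxCut can only decrease.  Conversely, a
    coordinate [k] of the union of the supports of [x] and [y] that meets no
    other such coordinate in its bucket contributes the full [|x_k - y_k|^p]
    to the distance of the images, and [k] fails to be isolated with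
    probability at most [2s/m].  Applying this to the pairs separated by one
    fixed maximum cut of [X] bounds the expected loss by
    [2s/m * MaxCut(X) <= 2 eps^2 MaxCut(X)]. *)

(** * Contraction of distances under the base mapping *)

Lemma lpnorm_powR (R : realType) (d : nat) (p : R) (x : 'rV[R]_d) :
  0 < p -> lpnorm p x `^ p = \sum_(k < d) `|x 0 k| `^ p.
Proof.
move=> p0; rewrite /lpnorm -powRrM mulVf ?gt_eqF// powRr1//.
by apply: sumr_ge0 => k _; exact: powR_ge0.
Qed.

Lemma basemap_empty (R : realType) (d m : nat) (a : {ffun 'I_d -> 'I_m})
    (x : 'rV[R]_d) (i : 'I_m) :
  (forall k, a k != i) -> basemap a x 0 i = 0.
Proof.
move=> ai; rewrite mxE; case: pickP => // k /eqP aki.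
by have := ai k; rewrite aki eqxx.
Qed.

Lemma basemap_ge (R : realType) (d m : nat) (a : {ffun 'I_d -> 'I_m})
    (x : 'rV[R]_d) (k : 'I_d) : x 0 k <= basemap a x 0 (a k).
Proof.
rewrite mxE; case: pickP => [j0 _|/(_ k)]; last by rewrite eqxx.
by apply: (le_bigmax_cond (x 0 j0) (fun j => x 0 j)).
Qed.

Lemma basemap_attained (R : realType) (d m : nat) (a : {ffun 'I_d -> 'I_m})
    (x : 'rV[R]_d) (k : 'I_d) :
  exists2 l, a l = a k & basemap a x 0 (a k) = x 0 l.
Proof.
rewrite mxE; case: pickP => [j0 /eqP aj0|/(_ k)]; last by rewrite eqxx.
apply: (big_ind (fun v => exists2 l, a l = a k & v = x 0 l)).
- by exists j0.
- by move=> u v Hu Hv; rewrite /Order.max; case: ifP.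
- by move=> l /eqP al; exists l.
Qed.

(** Take for [l] a maximiser of the vector with the larger bucket maximum: the other vector's
    maximum is at least its own entry at [l]. *)
Lemma basemap_lipschitz (R : realType) (d m : nat) (a : {ffun 'I_d -> 'I_m})
    (x y : 'rV[R]_d) (k : 'I_d) :
  exists2 l, a l = a k &
    `|basemap a x 0 (a k) - basemap a y 0 (a k)| <= `|x 0 l - y 0 l|.
Proof.
wlog xy : x y / basemap a y 0 (a k) <= basemap a x 0 (a k).
  move=> H; have [/H//|/ltW/H[l al h]] :=
    leP (basemap a y 0 (a k)) (basemap a x 0 (a k)).
  by exists l => //; rewrite distrC [leRHS]distrC.
have [l al xl] := basemap_attained R d m a x k.
exists l => //; rewrite ger0_norm ?subr_ge0// xl (le_trans _ (ler_norm _))//.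
by rewrite lerB// -al basemap_ge.
Qed.

Lemma basemap_contracting (R : realType) (d m : nat)
    (a : {ffun 'I_d -> 'I_m}) (p : R) (x y : 'rV[R]_d) : 0 < p ->
  lpnorm p (basemap a x - basemap a y) `^ p <= lpnorm p (x - y) `^ p.
Proof.
move=> p0; rewrite !lpnorm_powR// [leRHS](partition_big a xpredT)//=.
apply: ler_sum => i _.
(* In an empty bucket both images take the default value [0]; in any other, one term of the block
   already dominates. *)
have [k /eqP aki|ai] := pickP (fun k => a k == i); last first.
  have ai' k : a k != i by rewrite ai.
  have := basemap_empty R d m a x i ai'; have := basemap_empty R d m a y i ai'.
  rewrite !mxE => -> ->; rewrite subrr normr0 powR0 ?gt_eqF//.
  by apply: sumr_ge0 => k _; exact: powR_ge0.
rewrite -aki; have [l al h] := basemap_lipschitz R d m a x y k.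
rewrite (bigD1 l) ?al//= ler_wpDr//.
  by apply: sumr_ge0 => ? _; exact: powR_ge0.
apply: ge0_ler_powR; rewrite ?nnegrE//; first exact: ltW.
by move: h; rewrite !mxE.
Qed.

(** * Collisions: the loss of one pair, and how many functions collide *)

Definition collides (d m : nat) (a : {ffun 'I_d -> 'I_m}) (T : pred 'I_d)
    (k : 'I_d) : bool := [exists l, [&& T l, l != k & a l == a k]].

Definition jsupp (R : realType) (d : nat) (x y : 'rV[R]_d) : pred 'I_d :=
  [pred j | (x 0 j != 0) || (y 0 j != 0)].

Lemma card_jsupp (R : realType) (d s : nat) (x y : 'rV[R]_d) :
  sparse s x -> sparse s y -> (#|jsupp R d x y| <= 2 * s)%N.
Proof.
move=> xs ys; rewrite mul2n -addnn.
apply: leq_trans (leq_add xs ys); rewrite -cardUI; apply: leq_trans (leq_addr _ _).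
by apply: subset_leq_card; apply/fintype.subsetP => j; rewrite !inE.
Qed.

(** The bucket maximum is attained at [k] or at a coordinate where [x] vanishes; in the latter case
    nonnegativity forces [x 0 k] to be zero as well. *)
Lemma basemap_isolated (R : realType) (d m : nat)
    (a : {ffun 'I_d -> 'I_m}) (T : pred 'I_d) (x : 'rV[R]_d) (k : 'I_d) :
  nonneg_vec x -> (forall l, ~~ T l -> x 0 l = 0) -> ~~ collides d m a T k ->
  basemap a x 0 (a k) = x 0 k.
Proof.
move=> x0 xT /existsPn isok; have [l al xl] := basemap_attained R d m a x k.
case: (eqVneq l k) xl => [->//|lk xl].
have xl0 : x 0 l = 0.
  by apply: xT; have := isok l; rewrite lk al eqxx !andbT.
apply/eqP; rewrite eq_le basemap_ge andbT xl xl0; exact: x0.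
Qed.

Lemma basemap_loss (R : realType) (d m : nat)
    (a : {ffun 'I_d -> 'I_m}) (p : R) (x y : 'rV[R]_d) : 0 < p ->
  nonneg_vec x -> nonneg_vec y ->
  lpnorm p (x - y) `^ p - lpnorm p (basemap a x - basemap a y) `^ p <=
  \sum_(k < d) `|x 0 k - y 0 k| `^ p * (collides d m a (jsupp R d x y) k)%:R.
Proof.
(* Rearranged: the terms of the non-colliding coordinates sum to at most the distance of the images.
   This is checked bucket by bucket. *)
move=> p0 x0 y0; rewrite !lpnorm_powR// lerBlDl -lerBlDr -sumrB.
rewrite (partition_big a xpredT)//=; apply: ler_sum => i _.
set T := jsupp R d x y.
have xT l : ~~ T l -> x 0 l = 0 by rewrite /T/= negb_or !negbK => /andP[/eqP].
have yT l : ~~ T l -> y 0 l = 0 by rewrite /T/= negb_or !negbK => /andP[_ /eqP].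
have term0 l : ~~ T l || collides d m a T l ->
    `|(x - y) 0 l| `^ p - `|x 0 l - y 0 l| `^ p * (collides d m a T l)%:R = 0.
  rewrite !mxE; case/orP => [Tl|->]; last by rewrite mulr1 subrr.
  by rewrite xT// yT// subrr normr0 powR0 ?gt_eqF// mul0r subrr.
have [k /and3P[/eqP aki Tk isok]|noiso] :=
    pickP (fun k => [&& a k == i, T k & ~~ collides d m a T k]); last first.
  rewrite big1 ?powR_ge0// => l ali; apply: term0.
  by have := noiso l; rewrite ali/=; case: (T l) => //= /negbFE.
rewrite (bigD1 k) ?aki//= big1 ?addr0.
  rewrite (negbTE isok) mulr0 subr0 -aki.
  have := basemap_isolated R d m a T x k x0 xT isok.
  have := basemap_isolated R d m a T y k y0 yT isok.
  by rewrite !mxE => -> ->.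
(* Since [k] is isolated, every other coordinate of its bucket lies outside the joint support. *)
move=> l /andP[/eqP ali lk]; apply: term0.
by move/existsPn: isok => /(_ l); rewrite lk ali aki eqxx !andbT => ->.
Qed.

(* Overwriting the value at [k] by an arbitrary one is injective on the
   functions that agree at [k] and [l], since [a k] is remembered by [a l]. *)
Lemma card_collision (d m : nat) (k l : 'I_d) : l != k ->
  (#|[pred a : {ffun 'I_d -> 'I_m} | a l == a k]| * m
     <= #|{ffun 'I_d -> 'I_m}|)%N.
Proof.
move=> lk; rewrite -[X in (_ * X)%N]card_ord.
pose A := [pred a : {ffun 'I_d -> 'I_m} | a l == a k].
pose upd (u : {ffun 'I_d -> 'I_m} * 'I_m) : {ffun 'I_d -> 'I_m} :=
  [ffun j => if j == k then u.2 else u.1 j].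
rewrite -cardX -(@card_in_image _ _ upd); first exact: max_card.
move=> [a i] [b j]; rewrite !inE/= !andbT => /eqP alk /eqP blk /ffunP ab.
have E r : r != k -> a r = b r.
  by move=> rk; have := ab r; rewrite !ffunE (negbTE rk).
congr pair; last by have := ab k; rewrite !ffunE eqxx.
apply/ffunP => r; have [->|/E//] := eqVneq r k.
by rewrite -alk -blk E.
Qed.

(** Union bound over the possible partners [l] of [k] in [T], each colliding with [k] for at most a
    fraction [1/m] of the functions. *)
Lemma sum_collides (R : realType) (d m : nat) (T : pred 'I_d) (k : 'I_d) :
  \sum_(a : {ffun 'I_d -> 'I_m}) (collides d m a T k)%:R
    <= #|T|%:R / m%:R * #|{ffun 'I_d -> 'I_m}|%:R :> R.
Proof.
(* For [m = 0] the coordinate [k] has no possible image, so the sum is empty. *)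
have [->|m0] := posnP m.
  by rewrite big1 => [|a]; [rewrite invr0 mulr0 mul0r|case: (a k)].
apply: (@le_trans _ _ (\sum_(a : {ffun 'I_d -> 'I_m})
    \sum_(l in T | l != k) (a l == a k)%:R)).
  apply: ler_sum => a _; case: (boolP (collides _ _ _ _ _)); last first.
    by move=> _; apply: sumr_ge0.
  case/existsP => l /and3P[Tl lk alk].
  by rewrite (bigD1 l) ?lk ?andbT//= alk ler_wpDr//; apply: sumr_ge0.
rewrite exchange_big/=.
apply: (@le_trans _ _ (\sum_(l in T | l != k)
    (#|{ffun 'I_d -> 'I_m}|%:R / m%:R))).
  apply: ler_sum => l /andP[_ lk].
  rewrite ler_pdivlMr ?ltr0n// -natr_sum -natrM ler_nat.
  by rewrite -[X in (X * _)%N]big_mkcond/= sum1_card card_collision.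
apply: (@le_trans _ _ (\sum_(l in T) (#|{ffun 'I_d -> 'I_m}|%:R / m%:R))).
  rewrite [leRHS](bigID (fun l => l != k))/= ler_wpDr//.
  by apply: sumr_ge0 => l _; rewrite divr_ge0.
by rewrite sumr_const -[leLHS]mulr_natl mulrCA mulrC.
Qed.

(** * From pairs of points to maximum cuts *)

Section cuts.
Variables (R : realType) (I : finType) (p : R).

Definition cut (d : nat) (Y : I -> 'rV[R]_d) (S : {set I}) : R :=
  \sum_(i in S) \sum_(j in ~: S) lpnorm p (Y i - Y j) `^ p.

Lemma le_cut_maxcut (d : nat) (Y : I -> 'rV[R]_d) (S : {set I}) :
  cut d Y S <= maxcut p Y.
Proof. exact: (le_bigmax_cond 0 (cut d Y)). Qed.

Lemma maxcut_attained (d : nat) (Y : I -> 'rV[R]_d) :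
  exists S, maxcut p Y = cut d Y S.
Proof.
apply: (big_ind (fun v => exists S, v = cut d Y S)).
- by exists finset.set0; rewrite /cut big_set0.
- by move=> u v Hu Hv; rewrite /Order.max; case: ifP.
- by move=> S _; exists S.
Qed.

Lemma maxcut_basemap_le (d m : nat) (a : {ffun 'I_d -> 'I_m})
    (X : I -> 'rV[R]_d) : 0 < p ->
  maxcut p (fun i => basemap a (X i)) <= maxcut p X.
Proof.
move=> p0; have [S ->] := maxcut_attained m (fun i => basemap a (X i)).
apply: le_trans (le_cut_maxcut d X S).
by do 2![apply: ler_sum => ? _]; exact: basemap_contracting.
Qed.

Lemma sum_maxcut_loss (d m s : nat) (X : I -> 'rV[R]_d) : 0 < p ->
  (forall i, nonneg_vec (X i)) -> (forall i, sparse s (X i)) ->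
  \sum_(a : {ffun 'I_d -> 'I_m})
      (maxcut p X - maxcut p (fun i => basemap a (X i)))
    <= (2 * s)%:R / m%:R * #|{ffun 'I_d -> 'I_m}|%:R * maxcut p X.
Proof.
move=> p0 X0 Xs; have [S XS] := maxcut_attained d X.
set D := _ * #|_|%:R.
apply: (@le_trans _ _ (\sum_(a : {ffun 'I_d -> 'I_m})
    \sum_(i in S) \sum_(j in ~: S) \sum_(k < d)
    `|X i 0 k - X j 0 k| `^ p * (collides d m a (jsupp R d (X i) (X j)) k)%:R)).
  apply: ler_sum => a _; rewrite XS.
  (* The cut [S], optimal for [X], is a candidate for every image, so one choice of [S] serves all
     [a]. *)
  apply: (@le_trans _ _ (cut d X S - cut m (fun i => basemap a (X i)) S)).
    by rewrite lerB// le_cut_maxcut.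
  rewrite -sumrB; apply: ler_sum => i _; rewrite -sumrB; apply: ler_sum => j _.
  exact: basemap_loss.
rewrite exchange_big/= XS mulr_sumr; apply: ler_sum => i _.
rewrite exchange_big/= mulr_sumr; apply: ler_sum => j _.
rewrite exchange_big/= lpnorm_powR// mulr_sumr; apply: ler_sum => k _.
rewrite -mulr_sumr mulrC !mxE ler_wpM2r ?powR_ge0//.
apply: le_trans (sum_collides _ _ _ _ _) _.
by rewrite /D !ler_wpM2r ?invr_ge0// ler_nat card_jsupp.
Qed.

End cuts.

(** * Expectation over the random function *)

Lemma expectation_uniform (R : realType) (disp : measure_display)
    (Omega : measurableType disp) (P : probability Omega R) (d m : nat)
    (h : Omega -> {ffun 'I_d -> 'I_m}) (g : {ffun 'I_d -> 'I_m} -> R) :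
  uniform_random_function P h -> (forall a, 0 <= g a) ->
  ('E_P[fun w => g (h w)] =
    (#|{ffun 'I_d -> 'I_m}|%:R^-1 * \sum_a g a)%:E)%E.
Proof.
move=> Ph g0; rewrite unlock.
have mh a : measurable (h @^-1` [set a]) := (Ph a).1.
(* Writing the integrand as a finite combination of indicators of the fibres of [h] reduces
   everything to the measures of these fibres. *)
transitivity (\int[P]_w \sum_(a : {ffun 'I_d -> 'I_m})
    ((g a)%:E * (\1_(h @^-1` [set a]) w)%:E))%E.
  apply: eq_integral => w _; rewrite (bigD1 (h w))//= big1 ?adde0.
    by rewrite indicE mem_set// mule1.
  move=> a ahw; rewrite indicE memNset ?mule0//= => hwa.
  by rewrite hwa eqxx in ahw.
rewrite ge0_integral_sum//=; last 2 first.
- by move=> a; apply/measurable_EFinP; apply: measurable_funM.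
- by move=> a w _; rewrite -EFinM lee_fin mulr_ge0.
rewrite mulr_sumr -sumEFin; apply: eq_bigr => a _.
rewrite ge0_integralZl//=; last 2 first.
- exact/measurable_EFinP.
- by rewrite lee_fin.
rewrite integral_indic// setIT EFinM muleC; congr (_ * _)%E.
exact: (Ph a).2.
Qed.

Theorem mainTheorem17 (R : realType) :
  exists c C : R, 0 < c /\ 0 < C /\
    forall (eps : R) (d n s : nat) (X : 'I_n -> 'rV[R]_d),
      0 < eps < 1 ->
      (forall i, nonneg_vec (X i)) ->
      (forall i, sparse s (X i)) ->
      forall m : nat, m%:Z = Num.ceil (c * s%:R / eps ^+ 2) ->
      forall (disp : measure_display) (Omega : measurableType disp)
        (P : probability Omega R) (h : Omega -> {ffun 'I_d -> 'I_m}),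
        uniform_random_function P h ->
      forall p : R, 1 <= p ->
        ('E_P[fun w : Omega =>
           `| maxcut p (fun i => basemap (h w) (X i)) - maxcut p X |%R]
         <= (C * eps * maxcut p X)%:E)%E.
Proof.
(* With [c = 1], [s/m] is at most [eps ^+ 2], hence at most [eps]; [C = 2] because two [s]-sparse
   supports have a union of size at most [2 * s]. *)
exists 1, 2; split => //; split => // eps d n s X /andP[e0 e1] X0 Xs m mE
  disp Omega P h Ph p p1.
have p0 : 0 < p by apply: lt_le_trans p1.
rewrite (expectation_uniform _ _ _ _ _ _ _
  (fun a => `|maxcut p (fun i => basemap a (X i)) - maxcut p X|))// lee_fin.
under eq_bigr => a _ do rewrite distrC ger0_norm ?subr_ge0 ?maxcut_basemap_le//.
have MX0 : 0 <= maxcut p X.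
  have [S ->] := maxcut_attained R _ p d X.
  by do 2![apply: sumr_ge0 => ? _]; exact: powR_ge0.
have sm : s%:R / m%:R <= eps :> R.
  have : s%:R / eps ^+ 2 <= m%:R :> R.
    by have := ceil_ge (1 * s%:R / eps ^+ 2 : R); rewrite -mE mul1r.
  rewrite ler_pdivrMr ?exprn_gt0// => sme.
  have [->|m0] := posnP m; first by rewrite invr0 mulr0 ltW.
  rewrite ler_pdivrMr ?ltr0n// (le_trans sme)// mulrC ler_wpM2r//.
  by rewrite expr2 ler_piMl// ltW.
apply: (@le_trans _ _ (#|{ffun 'I_d -> 'I_m}|%:R^-1 *
   ((2 * s)%:R / m%:R * #|{ffun 'I_d -> 'I_m}|%:R * maxcut p X))).
  by rewrite ler_wpM2l ?invr_ge0// sum_maxcut_loss.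
rewrite mulrA ler_wpM2r//; set N := #|_|%:R : R.
rewrite mulrC natrM -!mulrA ler_wpM2l// mulrA.
(* [N] vanishes when [m = 0 < d], so only an inequality is claimed. *)
have NN : N / N <= 1.
  by have [->|N0] := eqVneq N 0; [rewrite mul0r|rewrite divff].
by apply: le_trans sm; rewrite -[leRHS]mulr1 ler_wpM2l// divr_ge0.
Qed.
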